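(* Let $h_i^{\mathrm U}, h_j^{\mathrm D}>0$, $h_{ij}\ge 0$, $\chi\ge 0$, $W>0$, $\omega>0$, $P_{\mathrm{fix}}>0$. Let $R_{\mathrm{tot}}>0$, let $P_{\mathrm F}$ and $P_{\mathrm H}$ be the minimum total transmit powers with which full-duplex (FD) mode and half-duplex (HD) mode, respectively, achieve the data rate $R_{\mathrm{tot}}$ (so $R_{\mathrm F}=R_{\mathrm H}=R_{\mathrm{tot}}$), and let $\beta_{\mathrm F}=\dfrac{R_{\mathrm{tot}}}{\omega P_{\mathrm F}+P_{\mathrm{fix}}}$ and $\beta_{\mathrm H}=\dfrac{R_{\mathrm{tot}}}{\omega P_{\mathrm H}+P_{\mathrm{fix}}}$ be the corresponding energy efficiencies. If FD has a better energy-efficiency/spectral-efficiency tradeoff than HD, i.e. $\beta_{\mathrm F}>\beta_{\mathrm H}$, then $$h_{ij}(1+\chi)<\min\left(h_i^{\mathrm U},h_j^{\mathrm D}\right).$$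
   Context: An uplink user $i$ and a downlink user $j$ are served by a base station. The numbers $h_i^{\mathrm U}$, $h_j^{\mathrm D}$, $h_{ij}$ are the uplink, downlink and co-channel-interference carrier-to-noise ratios; $\chi$ is the (constant, normalized) residual self-interference power; $W$ is the bandwidth; $\omega$ is the inverse power amplifier efficiency; $P_{\mathrm{fix}}$ is the fixed circuit power. FD mode: with uplink and downlink transmit powers $p^{\mathrm U},p^{\mathrm D}\ge 0$, the total transmit power is $p^{\mathrm U}+p^{\mathrm D}$ and the data rate is $$R_{\mathrm F}=W\log_2\left(1+\frac{p^{\mathrm U}h_i^{\mathrm U}}{1+\chi}\right)+W\log_2\left(1+\frac{p^{\mathrm D}h_j^{\mathrm D}}{1+p^{\mathrm U}h_{ij}}\right).$$ HD mode: with transmit power $p\ge 0$, the data rate is $$R_{\mathrm H}=\max\left(W\log_2(1+p\,h_i^{\mathrm U}),\ W\log_2(1+p\,h_j^{\mathrm D})\right).$$ The two modes are compared at the same spectral efficiency $R_{\mathrm{tot}}/W$. *)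

(* Defs.v *)
(* World: Stdlib reals. *)
From Stdlib Require Import Reals.
Open Scope R_scope.

Definition is_minimum (A : R -> Prop) (m : R) : Prop :=
  A m /\ forall x, A x -> m <= x.

(* Argument names: [hU], [hD], [hij] are the uplink, downlink and co-channel
   carrier-to-noise ratios, [chi] the residual self-interference power and
   [W] the bandwidth. *)

Definition FD_rate (W chi hU hD hij pU pD : R) : R :=
  W * Rlog 2 (1 + pU * hU / (1 + chi))
  + W * Rlog 2 (1 + pD * hD / (1 + pU * hij)).

Definition HD_rate (W hU hD p : R) : R :=
  Rmax (W * Rlog 2 (1 + p * hU)) (W * Rlog 2 (1 + p * hD)).

(* The split of the total power [P] between uplink and downlink is free, so
   the minimum of this set is a minimum over all pairs [(pU, pD)]. *)
Definition FD_achieves (W chi hU hD hij Rtot P : R) : Prop :=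
  exists pU pD : R,
    0 <= pU /\ 0 <= pD /\ P = pU + pD /\
    FD_rate W chi hU hD hij pU pD = Rtot.

Definition HD_achieves (W hU hD Rtot P : R) : Prop :=
  0 <= P /\ HD_rate W hU hD P = Rtot.

Definition energy_efficiency (omega Pfix Rtot P : R) : R :=
  Rtot / (omega * P + Pfix).

(* Main.v *)
(* If [hij (1 + chi) >= min hU hD], then expanding the product of the two FD
   factors shows that it is at most [1 + (pU + pD) max hU hD]: HD mode on the
   better link with the same total power is at least as fast. A better energy
   efficiency would however mean that FD reaches [Rtot] with strictly less
   power than HD. *)
Require Import Defs.
From Stdlib Require Import Reals Lra.
Open Scope R_scope.

Lemma Rlog_2_eq (x : R) : Rlog 2 x = ln x / ln 2.
Proof. reflexivity. Qed.

Lemma ln_2_pos : 0 < ln 2.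
Proof. rewrite <- ln_1; apply ln_increasing; lra. Qed.

Lemma Rlog_2_mult (x y : R) :
  0 < x -> 0 < y -> Rlog 2 (x * y) = Rlog 2 x + Rlog 2 y.
Proof.
intros Hx Hy; rewrite !Rlog_2_eq, ln_mult by assumption.
apply Rdiv_plus_distr.
Qed.

Lemma Rlog_2_lt (x y : R) : 0 < x -> x < y -> Rlog 2 x < Rlog 2 y.
Proof.
intros Hx Hxy; rewrite !Rlog_2_eq.
apply Rmult_lt_compat_r; [apply Rinv_0_lt_compat, ln_2_pos |].
now apply ln_increasing.
Qed.

Lemma FD_product_le (hU hD hij chi pU pD M : R) :
  0 < hU -> 0 < hD -> 0 <= hij -> 0 <= chi -> 0 <= pU -> 0 <= pD ->
  hU <= M -> hD <= M -> Rmin hU hD <= hij * (1 + chi) ->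
  (1 + pU * hU / (1 + chi)) * (1 + pD * hD / (1 + pU * hij))
  <= 1 + (pU + pD) * M.
Proof.
intros HhU HhD Hhij Hchi HpU HpD HUM HDM Hmin.
set (a := pU * hU / (1 + chi)).
assert (Ha : a * (1 + chi) = pU * hU) by (unfold a; field; lra).
assert (Ha0 : 0 <= a) by nra.
assert (HaM : a <= pU * M) by nra.
assert (HI : 0 < 1 + pU * hij) by nra.
(* [(1 + a) (1 + b) = 1 + a + b (1 + a)]: it remains to bound [b (1 + a)]. *)
assert (Hkey : hD * (1 + a) <= M * (1 + pU * hij)).
{ assert (Hcase : hU <= hij * (1 + chi) \/ hD <= hij * (1 + chi)).
  { revert Hmin; unfold Rmin; destruct (Rle_dec hU hD); auto. }
  destruct Hcase as [Hc | Hc].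
  - assert (a <= pU * hij).
    { apply Rmult_le_reg_r with (1 + chi); [lra |].
      rewrite Ha, Rmult_assoc; now apply Rmult_le_compat_l. }
    apply Rmult_le_compat; lra.
  - assert (hD * a <= pU * hij * hU).
    { apply Rmult_le_reg_r with (1 + chi); [lra |].
      rewrite Rmult_assoc, Ha.
      assert (0 <= pU * hU) by nra.
      nra. }
    assert (0 <= pU * hij) by nra.
    nra. }
assert (Hb : pD * hD / (1 + pU * hij) * (1 + a) <= pD * M).
{ apply Rmult_le_reg_r with (1 + pU * hij); [exact HI |].
  replace (pD * hD / (1 + pU * hij) * (1 + a) * (1 + pU * hij))
    with (pD * (hD * (1 + a))) by (field; lra).
  rewrite Rmult_assoc; now apply Rmult_le_compat_l. }
lra.
Qed.

Lemma FD_rate_lt_HD_rate (hU hD hij chi W pU pD p : R) :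
  0 < hU -> 0 < hD -> 0 <= hij -> 0 <= chi -> 0 < W ->
  0 <= pU -> 0 <= pD -> pU + pD < p -> Rmin hU hD <= hij * (1 + chi) ->
  FD_rate W chi hU hD hij pU pD < HD_rate W hU hD p.
Proof.
intros HhU HhD Hhij Hchi HW HpU HpD Hp Hmin.
assert (HU : 0 < 1 + pU * hU / (1 + chi)).
{ apply Rplus_lt_le_0_compat; [lra |].
  apply Rle_mult_inv_pos; [apply Rmult_le_pos |]; lra. }
assert (HD : 0 < 1 + pD * hD / (1 + pU * hij)).
{ apply Rplus_lt_le_0_compat; [lra |].
  apply Rle_mult_inv_pos; [apply Rmult_le_pos; lra | nra]. }
unfold FD_rate; rewrite <- Rmult_plus_distr_l, <- Rlog_2_mult by assumption.
assert (Hlt : forall M, hU <= M -> hD <= M ->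
  W * Rlog 2 ((1 + pU * hU / (1 + chi)) * (1 + pD * hD / (1 + pU * hij)))
  < W * Rlog 2 (1 + p * M)).
{ intros M HUM HDM; apply Rmult_lt_compat_l; [exact HW |].
  apply Rlog_2_lt; [now apply Rmult_lt_0_compat |].
  apply Rle_lt_trans with (1 + (pU + pD) * M); [now apply FD_product_le |].
  apply Rplus_lt_compat_l, Rmult_lt_compat_r; lra. }
unfold HD_rate; destruct (Rle_dec hU hD).
- eapply Rlt_le_trans; [apply (Hlt hD); lra | apply Rmax_r].
- eapply Rlt_le_trans; [apply (Hlt hU); lra | apply Rmax_l].
Qed.

Lemma energy_efficiency_gt_inv (omega Pfix Rtot P Q : R) :
  0 < omega -> 0 < Pfix -> 0 < Rtot -> 0 <= P -> 0 <= Q ->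
  energy_efficiency omega Pfix Rtot P > energy_efficiency omega Pfix Rtot Q ->
  P < Q.
Proof.
intros Ho Hf HR HP HQ Hgt; apply Rnot_le_lt; intro HQP.
apply (Rgt_not_le _ _ Hgt); unfold energy_efficiency.
apply Rmult_le_compat_l; [lra |].
apply Rinv_le_contravar; nra.
Qed.

Theorem theorem1 :
  forall (hU hD hij chi W omega Pfix Rtot PF PH : R),
    0 < hU -> 0 < hD -> 0 <= hij -> 0 <= chi ->
    0 < W -> 0 < omega -> 0 < Pfix -> 0 < Rtot ->
    is_minimum (FD_achieves W chi hU hD hij Rtot) PF ->
    is_minimum (HD_achieves W hU hD Rtot) PH ->
    energy_efficiency omega Pfix Rtot PF > energy_efficiency omega Pfix Rtot PH ->
    hij * (1 + chi) < Rmin hU hD.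
Proof.
intros hU hD hij chi W omega Pfix Rtot PF PH HhU HhD Hhij Hchi HW Ho Hf HR
  [[pU [pD [HpU [HpD [-> HF]]]]] _] [[HPH HH] _] Hgt.
apply energy_efficiency_gt_inv in Hgt; [| lra ..].
apply Rnot_le_lt; intro Hmin.
apply (Rlt_irrefl Rtot); rewrite <- HF at 1; rewrite <- HH.
now apply FD_rate_lt_HD_rate.
Qed.
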